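(* Let $R$ be a hemiring and let $A=(\mu_A,\lambda_A)$ be an intuitionistic fuzzy left $h$-ideal of $R$. Then $A$ is intuitionistic fuzzy characteristic if and only if each nonempty level set $U(\mu_A,\alpha)$ and each nonempty level set $L(\lambda_A,\beta)$ ($\alpha,\beta\in[0,1]$) is a characteristic left $h$-ideal of $R$.
   Context: A hemiring $(R,+,\cdot)$ is a set with two associative operations, $+$ commutative, $\cdot$ distributing over $+$ on both sides, and an element $0$ with $0+x=x+0=x$ and $0x=x0=0$ for all $x$. A left $h$-ideal of $R$ is a nonempty subset $I\subseteq R$ closed under addition, with $RI\subseteq I$, such that for all $x,z\in R$ and $a,b\in I$, $x+a+z=b+z$ implies $x\in I$. A left $h$-ideal $I$ is characteristic if $f(I)=I$ for every $f\in \mathrm{Aut}(R)$, where $\mathrm{Aut}(R)$ is the set of all automorphisms of the hemiring $R$. An intuitionistic fuzzy set (IFS) on $R$ is a pair $A=(\mu_A,\lambda_A)$ of functions $R\to[0,1]$ with $\mu_A(x)+\lambda_A(x)\le 1$ for all $x\in R$. It is an intuitionistic fuzzy (IF) left $h$-ideal of $R$ if for all $a,b,x,y,z\in R$: (1) $\mu_A(x+y)\ge\min\{\mu_A(x),\mu_A(y)\}$; (2) $\lambda_A(x+y)\le\max\{\lambda_A(x),\lambda_A(y)\}$; (3) $\mu_A(xy)\ge\mu_A(y)$; (4) $\lambda_A(xy)\le\lambda_A(y)$; (5) $x+a+z=b+z$ implies $\mu_A(x)\ge\min\{\mu_A(a),\mu_A(b)\}$; (6) $x+a+z=b+z$ implies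 $\lambda_A(x)\le\max\{\lambda_A(a),\lambda_A(b)\}$. An IFS $A=(\mu_A,\lambda_A)$ on $R$ is called intuitionistic fuzzy characteristic if $\mu_A(f(x))=\mu_A(x)$ and $\lambda_A(f(x))=\lambda_A(x)$ for all $x\in R$ and $f\in\mathrm{Aut}(R)$. Level sets: $U(\mu_A,\alpha)=\{x\in R: \mu_A(x)\ge\alpha\}$ and $L(\lambda_A,\beta)=\{x\in R:\lambda_A(x)\le\beta\}$. *)

(* Defs.v *)
From HB Require Import structures.
From mathcomp Require Import all_boot all_order all_algebra.
From mathcomp Require Import boolp classical_sets reals.
Set Implicit Arguments.
Unset Strict Implicit.
Unset Printing Implicit Defensive.
Import Order.TTheory GRing.Theory Num.Theory.
Local Open Scope classical_set_scope.
Local Open Scope ring_scope.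

(* The commutative monoid (R, +, 0) is the inherited nmodType structure.  The
   product is neither commutative nor unital, so ssralg's semirings, all of
   which have a 1, do not apply. *)
HB.mixin Record Nmodule_isHemiring R of GRing.Nmodule R := {
  hmul : R -> R -> R;
  hmulA : associative hmul;
  hmulDl : left_distributive hmul +%R;
  hmulDr : right_distributive hmul +%R;
  hmul0x : left_zero 0 hmul;
  hmulx0 : right_zero 0 hmul
}.

#[short(type="hemiringType")]
HB.structure Definition Hemiring := {R of Nmodule_isHemiring R & GRing.Nmodule R}.

(* nmod_morphism contains f 0 = 0, which is automatic for an additive
   bijection. *)
Definition hemiring_aut (R : hemiringType) : set (R -> R) :=
  [set f | [/\ bijective f, nmod_morphism f & {morph f : x y / hmul x y}]].

Record left_h_ideal (R : hemiringType) (I : set R) : Prop := LeftHIdeal {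
  lhi_nonempty : I !=set0;
  lhi_add : forall a b, I a -> I b -> I (a + b);
  lhi_mul : forall r a, I a -> I (hmul r a);
  lhi_h : forall x z a b, I a -> I b -> x + a + z = b + z -> I x
}.

Definition characteristic_left_h_ideal (R : hemiringType) (I : set R) : Prop :=
  left_h_ideal I /\ forall f, hemiring_aut f -> f @` I = I.

Record ifs (K : realType) (T : Type) := IFS {
  ifs_mu : T -> K;
  ifs_lambda : T -> K;
  ifs_mu_itv : forall x, 0 <= ifs_mu x <= 1;
  ifs_lambda_itv : forall x, 0 <= ifs_lambda x <= 1;
  ifs_le1 : forall x, ifs_mu x + ifs_lambda x <= 1
}.

Record if_left_h_ideal (K : realType) (R : hemiringType) (A : ifs K R) : Prop :=
  IFLeftHIdeal {
  iflhi_muD : forall x y,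
    ifs_mu A (x + y) >= Num.min (ifs_mu A x) (ifs_mu A y);
  iflhi_lambdaD : forall x y,
    ifs_lambda A (x + y) <= Num.max (ifs_lambda A x) (ifs_lambda A y);
  iflhi_muM : forall x y, ifs_mu A (hmul x y) >= ifs_mu A y;
  iflhi_lambdaM : forall x y, ifs_lambda A (hmul x y) <= ifs_lambda A y;
  iflhi_muh : forall a b x z, x + a + z = b + z ->
    ifs_mu A x >= Num.min (ifs_mu A a) (ifs_mu A b);
  iflhi_lambdah : forall a b x z, x + a + z = b + z ->
    ifs_lambda A x <= Num.max (ifs_lambda A a) (ifs_lambda A b)
}.

Definition if_characteristic (K : realType) (R : hemiringType) (A : ifs K R) :
    Prop :=
  forall x f, hemiring_aut f ->
    ifs_mu A (f x) = ifs_mu A x /\ ifs_lambda A (f x) = ifs_lambda A x.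

Definition upper_level (K : realType) (T : Type) (mu : T -> K) (alpha : K) :
  set T := [set x | mu x >= alpha].

Definition lower_level (K : realType) (T : Type) (lambda : T -> K) (beta : K) :
  set T := [set x | lambda x <= beta].

(* Main.v *)
(* For a bijection f, f @` I = I means that I x and I (f x) are equivalent for
   all x.  Hence f preserves the level sets as soon as it preserves mu and
   lambda; conversely the level sets at the heights mu x and mu (f x)
   (lambda x and lambda (f x)) compare the values at x and f x both ways. *)
Require Import Defs.
From mathcomp Require Import all_boot all_order all_algebra.
From mathcomp Require Import boolp classical_sets reals.
Local Open Scope classical_set_scope.
Local Open Scope ring_scope.
Import Order.TTheory.

(** Injectivity forces a preimage of [f x] lying in [I] to be [x] itself; surjectivity puts every
    point of [I] in the image. *)
Lemma bij_image_fixedP (T : Type) (f : T -> T) (I : set T) :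
  bijective f -> (f @` I = I <-> forall x, I (f x) <-> I x).
Proof.
move=> fbij; split=> [fI x|fI].
  split=> [|Ix]; rewrite -{1}fI; last by exists x.
  by move=> [y Iy /(bij_inj fbij) <-].
case: fbij => g _ gK; apply/seteqP; split=> [_ [x Ix <-]|x Ix].
  exact/fI.
(* The preimage [g x] lies in [I] because its image [x] does. *)
by exists (g x); rewrite ?gK //; apply/fI; rewrite gK.
Qed.

Lemma upper_level_left_h_ideal (K : realType) (R : hemiringType) (A : ifs K R)
    (alpha : K) :
  if_left_h_ideal A -> upper_level (ifs_mu A) alpha !=set0 ->
  left_h_ideal (upper_level (ifs_mu A) alpha).
Proof.
rewrite /upper_level => hA U0; split=> //= [a b Ua Ub|r a Ua|x z a b Ua Ub xab].
- by apply: le_trans (iflhi_muD hA a b); rewrite le_min Ua Ub.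
- exact: le_trans Ua (iflhi_muM hA r a).
- by apply: le_trans (iflhi_muh hA xab); rewrite le_min Ua Ub.
Qed.

Lemma lower_level_left_h_ideal (K : realType) (R : hemiringType) (A : ifs K R)
    (beta : K) :
  if_left_h_ideal A -> lower_level (ifs_lambda A) beta !=set0 ->
  left_h_ideal (lower_level (ifs_lambda A) beta).
Proof.
rewrite /lower_level => hA L0; split=> //= [a b La Lb|r a La|x z a b La Lb xab].
- by apply: le_trans (iflhi_lambdaD hA a b) _; rewrite ge_max La Lb.
- exact: le_trans (iflhi_lambdaM hA r a) La.
- by apply: le_trans (iflhi_lambdah hA xab) _; rewrite ge_max La Lb.
Qed.

Theorem theorem12 (K : realType) (R : hemiringType) (A : ifs K R)
    (hA : if_left_h_ideal A) :
  if_characteristic A <->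
  ((forall alpha : K, 0 <= alpha <= 1 -> upper_level (ifs_mu A) alpha !=set0 ->
      characteristic_left_h_ideal (upper_level (ifs_mu A) alpha)) /\
   (forall beta : K, 0 <= beta <= 1 -> lower_level (ifs_lambda A) beta !=set0 ->
      characteristic_left_h_ideal (lower_level (ifs_lambda A) beta))).
Proof.
split=> [Achar|[Uchar Lchar] x f faut].
  split=> [alpha _ U0|beta _ L0]; split.
  - exact: upper_level_left_h_ideal.
  - move=> f faut; case: (faut) => fbij _ _; apply/(bij_image_fixedP _ _ _ fbij) => x.
    by rewrite /upper_level /= (Achar x f faut).1.
  - exact: lower_level_left_h_ideal.
  - move=> f faut; case: (faut) => fbij _ _; apply/(bij_image_fixedP _ _ _ fbij) => x.
    by rewrite /lower_level /= (Achar x f faut).2.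
case: (faut) => fbij _ _.
(* The height [ifs_mu A y] lies in the unit interval and its level set contains [y], so [Uchar]
   applies. Keeping [y] apart from [z] allows both heights, at [x] and at [f x]. *)
have Uf y z : upper_level (ifs_mu A) (ifs_mu A y) (f z) <->
              upper_level (ifs_mu A) (ifs_mu A y) z.
  have U0 : upper_level (ifs_mu A) (ifs_mu A y) !=set0 by exists y; apply: lexx.
  have [_ fU] := Uchar _ (ifs_mu_itv A y) U0.
  exact: (bij_image_fixedP _ _ _ fbij).1 (fU f faut) z.
have Lf y z : lower_level (ifs_lambda A) (ifs_lambda A y) (f z) <->
              lower_level (ifs_lambda A) (ifs_lambda A y) z.
  have L0 : lower_level (ifs_lambda A) (ifs_lambda A y) !=set0 by exists y; apply: lexx.
  have [_ fL] := Lchar _ (ifs_lambda_itv A y) L0.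
  exact: (bij_image_fixedP _ _ _ fbij).1 (fL f faut) z.
(* Each inequality uses the level set at the height of one of [x], [f x]: it contains that point,
   hence also the other. Lower levels reverse the order, so the two heights swap roles for
   [ifs_lambda]. *)
split; apply/le_anti/andP; split.
- exact/(Uf (f x) x)/lexx.
- exact/(Uf x x)/lexx.
- exact/(Lf x x)/lexx.
- exact/(Lf (f x) x)/lexx.
Qed.
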